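(* Let $s \geq 3$ be a fixed integer. Suppose there are constants $C, c > 0$ such that for every sufficiently large $n$ there exists a $K_s$-free $(n,d,\lambda)$-graph with $\lambda \leq C\sqrt{d}$ and $d \geq c\, n^{1 - \frac{1}{2s-3}}$. Then there is a constant $c' > 0$ (depending on $s$, $C$, $c$) such that for all sufficiently large $t$, \[ r(s,t) \;\geq\; c'\,\frac{t^{s-1}}{(\log t)^{2s-4}}. \]
   Context: For integers $s,t \geq 2$, the Ramsey number $r(s,t)$ is the minimum $n$ such that every $n$-vertex graph contains either a clique of order $s$ or an independent set of size $t$. An $(n,d,\lambda)$-graph is an $n$-vertex $d$-regular graph whose adjacency matrix has eigenvalues $\lambda_1 \geq \lambda_2 \geq \dots \geq \lambda_n$ with $\max\{|\lambda_2|,|\lambda_n|\} = \lambda$. A graph is $K_s$-free if it contains no complete subgraph on $s$ vertices. An $(n,d,\lambda)$-graph with $\lambda = O(\sqrt{d})$ is called spectrally extremal. *)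

(* Defs.v *)
From HB Require Import structures.
From mathcomp Require Import all_boot all_order all_algebra.
From mathcomp Require Import reals exp.
Set Implicit Arguments. Unset Strict Implicit. Unset Printing Implicit Defensive.
Import Order.TTheory GRing.Theory Num.Theory.
Local Open Scope ring_scope.

Definition simple_graph (n : nat) (G : rel 'I_n) : Prop :=
  (forall x y, G x y = G y x) /\ (forall x, ~~ G x x).

Definition has_clique (n : nat) (G : rel 'I_n) (s : nat) : Prop :=
  exists S : {set 'I_n}, #|S| = s /\
    {in S &, forall x y, x != y -> G x y}.

Definition has_indep (n : nat) (G : rel 'I_n) (t : nat) : Prop :=
  exists S : {set 'I_n}, #|S| = t /\
    {in S &, forall x y, ~~ G x y}.

Definition Ks_free (n : nat) (G : rel 'I_n) (s : nat) : Prop := ~ has_clique G s.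

Definition ramsey_prop (s t n : nat) : Prop :=
  forall G : rel 'I_n, simple_graph G -> has_clique G s \/ has_indep G t.

(* r(s,t) >= x, i.e. the minimum n with ramsey_prop s t n is at least x;
   equivalently every n with the Ramsey property is at least x. *)
Definition ramsey_ge (R : realType) (s t : nat) (x : R) : Prop :=
  forall n : nat, ramsey_prop s t n -> x <= n%:R.

Definition regular (n : nat) (G : rel 'I_n) (d : nat) : Prop :=
  forall v : 'I_n, #|[set u | G v u]| = d.

Definition adj_matrix (R : realType) (n : nat) (G : rel 'I_n) : 'M[R]_n :=
  \matrix_(i, j) (G i j)%:R.

Definition eigen_seq (R : realType) (n : nat) (A : 'M[R]_n) (sp : seq R) : Prop :=
  size sp = n /\ sorted (fun x y => y <= x) sp /\
  char_poly A = \prod_(x <- sp) ('X - x%:P).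

Definition ndl_graph (R : realType) (n : nat) (G : rel 'I_n) (d : nat) (lam : R) : Prop :=
  simple_graph G /\ regular G d /\
  exists sp : seq R, eigen_seq (adj_matrix R G) sp /\
    lam = Num.max `|nth 0 sp 1| `|nth 0 sp n.-1|.

(* Main.v *)
(* Following Alon-Rodl and Mubayi-Verstraete.  In an (n,d,lambda)-graph the
   adjacency matrix contracts vectors orthogonal to the constant vector by
   lambda, so a vertex set B contains at most 2 lambda n / d vertices having at
   most half the expected number d|B|/n of neighbours in B.  Build an
   independent sequence of length t vertex by vertex, B being the set of common
   non-neighbours so far: apart from those few vertices, each choice shrinks B
   by a factor 1 - d/(2n).  Weighing B by |B|^(t / ln n), one gets at most
   (K n / sqrt d)^t independent sequences once t >= 2 n (ln n)^2 / d.
   A random map from m points to the vertices then pulls the graph back to a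
   K_s-free graph on m points without independent t-set as soon as
   m < t sqrt d / K'.  Taking n = k^(2s-3), with k a small multiple of
   t / (ln t)^2, gives the bound. *)
Require Import Defs.
From HB Require Import structures.
From mathcomp Require Import all_boot all_order all_algebra.
From mathcomp Require Import reals sequences exp.
From mathcomp Require Import complex.
From mathcomp Require Import zify ring lra.
Import Order.TTheory GRing.Theory Num.Theory.
Local Open Scope ring_scope.

(** * Contraction by a normal matrix on the complement of an eigenvector *)

Section Contraction.
Local Open Scope sesquilinear_scope.
Variable C : numClosedFieldType.

Lemma sqnormE n (x : 'rV[C]_n) : (x *m x ^t* ) 0 0 = \sum_i `|x 0 i| ^+ 2.
Proof. by rewrite mxE; apply: eq_bigr => i _; rewrite !mxE normCK. Qed.

Lemma char_poly_conj_diag n (P : 'M[C]_n) (D : 'rV[C]_n) :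
  P \in unitmx ->
  char_poly (invmx P *m diag_mx D *m P) = \prod_i ('X - (D 0 i)%:P).
Proof.
move=> Pu; rewrite /char_poly.
have Pp : map_mx polyC (invmx P) *m map_mx polyC P = 1%:M.
  by rewrite -map_mxM mulVmx // map_mx1.
have -> : char_poly_mx (invmx P *m diag_mx D *m P) =
    map_mx polyC (invmx P) *m char_poly_mx (diag_mx D) *m map_mx polyC P.
  rewrite /char_poly_mx mulmxBr mulmxBl !map_mxM; congr (_ - _).
  by rewrite mul_mx_scalar -scalemxAl Pp scalemx1.
rewrite !det_mulmx mulrAC -det_mulmx Pp det1 mul1r.
rewrite -[LHS]/(char_poly _) char_poly_trig ?diag_mx_is_trig //.
by apply: eq_bigr => i _; rewrite mxE eqxx.
Qed.

(** In a unitary eigenbasis norms are preserved and [A] acts diagonally, so it suffices to compare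
    coordinates. Apart from one entry equal to [d], the diagonal is bounded by [lam]; when [d] is
    larger in modulus, orthogonality to [u] kills that coordinate of [x]. *)
Lemma spectral_contraction n (A : 'M[C]_n) (u x : 'rV[C]_n) (d lam : C) (s : seq C) :
  A \is normalmx -> u != 0 -> u *m A = d *: u -> 0 <= lam ->
  char_poly A = \prod_(z <- d :: s) ('X - z%:P) ->
  {in s, forall z, `|z| <= lam} -> x *m u ^t* = 0 ->
  \sum_i `|(x *m A) 0 i| ^+ 2 <= lam ^+ 2 * \sum_i `|x 0 i| ^+ 2.
Proof.
move=> /orthomx_spectralP; set P := spectralmx A; set D := spectral_diag A.
move=> AE u0 uA lam0 cpA sle xu.
have Pu : P \in unitmx by exact: spectral_unit.
have PP : P *m P ^t* = 1%:M by exact/unitarymxP/spectral_unitarymx.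
have PiE : invmx P = P ^t* by exact/invmx_unitary/spectral_unitarymx.
have PP' : P ^t* *m P = 1%:M by rewrite -PiE mulVmx.
have isom (z : 'rV[C]_n) : \sum_i `|(z *m P) 0 i| ^+ 2 = \sum_i `|z 0 i| ^+ 2.
  by rewrite -!sqnormE trmx_mul map_mxM mulmxA -(mulmxA z) PP mulmx1.
pose y := x *m P ^t*; pose v := u *m P ^t*.
have xE : x = y *m P by rewrite -mulmxA PP' mulmx1.
have -> : x *m A = y *m diag_mx D *m P by rewrite AE PiE !mulmxA.
rewrite isom [in X in _ <= X]xE isom mulr_sumr.
have yDi i : (y *m diag_mx D) 0 i = y 0 i * D 0 i.
  by rewrite mul_mx_diag mxE.
have vDi i : v 0 i * D 0 i = d * v 0 i.
  have <- : (v *m diag_mx D) 0 i = v 0 i * D 0 i by rewrite mul_mx_diag mxE.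
  have -> : v *m diag_mx D = d *: v; last by rewrite mxE.
  rewrite /v scalemxAl -uA AE PiE -!mulmxA; congr (_ *m (_ *m _)).
  by rewrite PP mulmx1.
have yv : \sum_i y 0 i * (v 0 i)^* = 0.
  have : (y *m v ^t* ) 0 0 = 0.
    rewrite /v trmx_mul map_mxM trmxCK mulmxA -xE.
    by rewrite xu mxE.
  by rewrite mxE => yv0; rewrite -[RHS]yv0; apply: eq_bigr => i _; rewrite !mxE.
(* Two factorisations of the characteristic polynomial identify [d :: s] with the diagonal entries
   as multisets. *)
have perm : perm_eq (d :: s) [seq D 0 i | i <- enum 'I_n].
  apply: prod_XsubC_eq; rewrite -cpA AE char_poly_conj_diag // big_map.
  by rewrite big_enum.
have : d \in [seq D 0 i | i <- enum 'I_n] by rewrite -(perm_mem perm) mem_head.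
case/mapP => i0 _ di0.
have Dle i : i != i0 -> `|D 0 i| <= lam.
  move=> ii0; apply: sle.
  have : perm_eq (d :: s) (D 0 i0 :: [seq D 0 i | i <- rem i0 (enum 'I_n)]).
    apply: (perm_trans perm).
    exact: (perm_map (fun i => D 0 i) (perm_to_rem (mem_enum 'I_n i0))).
  rewrite -di0 perm_cons => /perm_mem ->.
  apply: map_f; rewrite mem_rem_uniq ?enum_uniq //.
  by rewrite inE ii0 mem_enum.
have lamR : lam \is Num.real by rewrite realE lam0.
(* If |d| > lam then d is a simple eigenvalue, so its eigenspace is spanned by
   u and the coordinate of x along it vanishes. *)
have key i : `|D 0 i| <= lam \/ y 0 i = 0.
  have [->|ii0] := eqVneq i i0; last by left; apply: Dle.
  have [dle|dgt] := real_leP (normr_real (D 0 i0)) lamR; first by left.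
  right.
  have vi j : j != i0 -> v 0 j = 0.
    move=> ji0; have /eqP := vDi j; rewrite mulrC -subr_eq0 -mulrBl mulf_eq0.
    case/orP => [|/eqP //]; rewrite subr_eq0 => /eqP Dd.
    by have := Dle _ ji0; rewrite Dd di0 => /(lt_le_trans dgt); rewrite ltxx.
  have vi0 : v 0 i0 != 0.
    apply: contraNneq u0 => vi0.
    have v0 : v = 0.
      apply/rowP => j; rewrite [RHS]mxE.
      by have [->|/vi] := eqVneq j i0.
    by rewrite -[u]mulmx1 -PP' mulmxA -/v v0 mul0mx.
  move: yv; rewrite (bigD1 i0) //= big1 ?addr0; last first.
    by move=> j /vi ->; rewrite conjC0 mulr0.
  by move/eqP; rewrite mulf_eq0 conjC_eq0 (negPf vi0) orbF => /eqP.
apply: ler_sum => i _; rewrite yDi normrM exprMn mulrC.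
case: (key i) => [Dl|->]; last by rewrite normr0 expr0n /= !mulr0.
by rewrite ler_wpM2r ?exprn_ge0 // lerXn2r // nnegrE.
Qed.

End Contraction.

(** * Spectrum of a regular graph *)

Section Regular.
Variables (R : realType) (n : nat) (G : rel 'I_n) (d : nat).
Hypotheses (Gsym : forall x y, G x y = G y x) (Greg : regular G d).
Local Notation A := (adj_matrix R G).

Lemma sum_adj_row i : \sum_j A i j = d%:R.
Proof.
rewrite -(Greg i) -sum1_card natr_sum [RHS]big_mkcond /=; apply: eq_bigr => j _.
by rewrite mxE inE; case: (G i j).
Qed.

Lemma sum_adj_col j : \sum_i A i j = d%:R.
Proof.
by rewrite -(sum_adj_row j); apply: eq_bigr => i _; rewrite !mxE Gsym.
Qed.

Lemma adj_ones : const_mx 1 *m A = d%:R *: const_mx 1 :> 'rV_n.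
Proof.
apply/rowP => j; rewrite !mxE mulr1 -(sum_adj_col j).
by apply: eq_bigr => i _; rewrite mxE mul1r.
Qed.

(** At a coordinate where the eigenvector is largest in modulus, the eigenvalue equation is a sum
    weighted by a column of total [d]. *)
Lemma adj_eigenvalue_le z : root (char_poly A) z -> `|z| <= d%:R.
Proof.
rewrite -eigenvalue_root_char => /eigenvalueP[v vA v0].
have [j0 vj0] : exists j, v 0 j != 0.
  by apply/rV0Pn.
have [j _ jmax] := @Order.TotalTheory.arg_maxP _ _ _ j0 predT (fun j => `|v 0 j|) isT.
have vj : 0 < `|v 0 j| by rewrite (lt_le_trans _ (jmax j0 isT)) // normr_gt0.
rewrite -(ler_pM2r vj) -normrM.
have -> : z * v 0 j = \sum_i v 0 i * A i j.
  by have /rowP /(_ j) := vA; rewrite !mxE.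
apply: (le_trans (ler_norm_sum _ _ _)).
rewrite -(sum_adj_col j) mulr_suml; apply: ler_sum => i _.
rewrite normrM mulrC mxE [X in X * _]ger0_norm ?ler0n //.
by apply: ler_wpM2l; [exact: ler0n | exact: jmax].
Qed.

End Regular.

(** Once [d] is split off the sorted spectrum, every other eigenvalue lies between the second and
    the last, hence has modulus at most [lam]. Zero sum means orthogonality to the all-ones
    eigenvector; the matrix is complexified to apply [spectral_contraction]. *)
Lemma ndl_contraction (R : realType) n (G : rel 'I_n) d (lam : R) (x : 'rV[R]_n) :
  ndl_graph G d lam -> \sum_i x 0 i = 0 ->
  \sum_i ((x *m adj_matrix R G) 0 i) ^+ 2 <= lam ^+ 2 * \sum_i (x 0 i) ^+ 2.
Proof.
case: n G x => [|n] G x; first by rewrite !big_ord0 mulr0 lexx.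
move=> [[Gsym _] [Greg [sp [[szsp [sp_sorted cpA]] lamE]]]] x0.
have ge_trans : transitive (fun x y : R => y <= x).
  by move=> y z t yz ty; apply: le_trans ty yz.
have nthle i j : (i <= j < n.+1)%N -> nth 0 sp j <= nth 0 sp i.
  move=> /andP[ij jn].
  apply: (sorted_leq_nth ge_trans (@lexx _ _) 0 sp_sorted) => //.
    by rewrite inE szsp (leq_ltn_trans ij).
  by rewrite inE szsp.
have rootsp z : root (char_poly (adj_matrix R G)) z = (z \in sp).
  by rewrite cpA root_prod_XsubC.
have dsp : (d%:R : R) \in sp.
  rewrite -rootsp -eigenvalue_root_char; apply/eigenvalueP.
  exists (const_mx 1); first exact: adj_ones.
  by apply/rV0Pn; exists ord0; rewrite mxE oner_neq0.
(* All roots are at most [d] in modulus and [d] is a root, so sortedness puts it first. *)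
have sp0 : nth 0 sp 0 = d%:R.
  apply/eqP; rewrite eq_le; apply/andP; split.
    apply: le_trans (ler_norm _) _.
    by apply: (adj_eigenvalue_le _ _ _ _ Gsym Greg); rewrite rootsp mem_nth ?szsp.
  by rewrite -(nth_index 0 dsp) nthle //= -szsp index_mem.
case: sp szsp {sp_sorted rootsp dsp} cpA lamE nthle sp0 => [//|e sp] szsp cpA lamE nthle /= sp0.
subst e.
have lam0 : 0 <= lam by rewrite lamE le_max normr_ge0.
have sple z : z \in sp -> `|z| <= lam.
  move=> zsp; have i_n : (index z sp < n)%N by move: szsp => [<-]; rewrite index_mem.
  have zE : z = nth 0 (d%:R :: sp) (index z sp).+1 by rewrite /= nth_index.
  have le1 : nth 0 (d%:R :: sp) n <= z by rewrite zE nthle // i_n ltnSn.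
  have le2 : z <= nth 0 (d%:R :: sp) 1 by rewrite zE nthle.
  rewrite lamE le_max !ler_norml.
  move: le1 le2; rewrite -[n]/(n.+1.-1).
  set p := nth 0 _ 1; set q := nth 0 _ _ => qz zp.
  case: (lerP 0 z) => z0.
    by rewrite (le_trans _ z0) ?oppr_le0 //= (le_trans zp) ?ler_norm.
  apply/orP; right; rewrite (le_trans (ltW z0)) ?normr_ge0 // andbT.
  by rewrite lerNl (@le_trans _ _ (- q)) ?lerN2 // -normrN ler_norm.
pose f := (real_complex R : {rmorphism R -> R[i]}).
have nf (z : R) : `|f z| = f `|z| by rewrite normc_def /= expr0n /= addr0 sqrtr_sqr.
have sq (z : 'rV[R]_n.+1) :
    \sum_i `|map_mx f z 0 i| ^+ 2 = f (\sum_i (z 0 i) ^+ 2).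
  rewrite rmorph_sum; apply: eq_bigr => i _.
  by rewrite mxE nf -rmorphXn /= real_normK ?num_real.
rewrite -lecR -[X in _ <= X]/(f _) -[X in X <= _]/(f _) rmorphM rmorphXn /= -!sq map_mxM.
apply: (@spectral_contraction _ _ _ (const_mx 1) _ (f d%:R) _ (map f sp)).
- apply: symmetric_normalmx.
    apply/is_hermitianmxP; rewrite expr0 scale1r; apply/matrixP => i j.
    by rewrite !mxE Gsym.
  by apply/mxOverP => i j; rewrite !mxE rmorph_nat realn.
- by apply/rV0Pn; exists ord0; rewrite mxE oner_neq0.
- by rewrite -[const_mx 1](map_const_mx f) -map_mxM (adj_ones _ _ _ d) // map_mxZ.
- by rewrite ler0c.
- rewrite -map_char_poly cpA rmorph_prod -map_cons big_map.
  by apply: eq_bigr => z _; rewrite /= map_polyXsubC.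
- by move=> _ /mapP[z zsp ->]; rewrite nf lecR sple.
- apply/matrixP => i j; rewrite !ord1 !mxE.
  rewrite -[RHS](rmorph0 f) -x0 rmorph_sum; apply: eq_bigr => k _.
  by rewrite !mxE conjC1 mulr1.
Qed.

(** * Few vertices have low degree into a given set *)

Section LowDegree.
Variables (R : realType) (n : nat) (G : rel 'I_n) (d : nat) (lam : R).
Hypothesis ndl : ndl_graph G d lam.

Lemma sum_indicator (B : {set 'I_n}) (p : pred 'I_n) :
  \sum_j (j \in B)%:R * (p j)%:R = #|[set j in B | p j]|%:R :> R.
Proof.
rewrite -sum1_card natr_sum [RHS]big_mkcond /=; apply: eq_bigr => j _.
by rewrite inE -natrM mulnb; case: (_ && _).
Qed.

(** The centred indicator [x] of [B] is orthogonal to constants. At each vertex of [U] its image is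
    at most [- (b * d / 2)], so the contraction bound limits the size of [U]. *)
Lemma ndl_low_degree (U B : {set 'I_n}) :
  (0 < n)%N -> (0 < #|B|)%N ->
  {in U, forall u, #|[set w in B | G u w]|%:R <= d%:R * #|B|%:R / (2 * n%:R) :> R} ->
  #|U|%:R * #|B|%:R * d%:R ^+ 2 <= 4 * lam ^+ 2 * n%:R ^+ 2.
Proof.
move=> n0 B0 low; have [[Gsym _] [Greg _]] := ndl.
have nR : (0 : R) < n%:R by rewrite ltr0n.
have BR : (0 : R) < #|B|%:R by rewrite ltr0n.
pose b : R := #|B|%:R / n%:R.
pose x : 'rV[R]_n := \row_j ((j \in B)%:R - b).
have cardB : \sum_j (j \in B)%:R = #|B|%:R :> R.
  by rewrite -sum1_card natr_sum [RHS]big_mkcond /=; apply: eq_bigr => j _; case: (_ \in _).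
have sumb : \sum_(j < n) b = #|B|%:R.
  by rewrite sumr_const card_ord -[LHS]mulr_natr /b divfK // gt_eqF.
have x0 : \sum_i x 0 i = 0.
  by under eq_bigr do rewrite mxE; rewrite sumrB cardB sumb subrr.
have x2 : \sum_i (x 0 i) ^+ 2 <= #|B|%:R.
  (* The indicator is idempotent, so the square becomes linear in the indicator and [x], and the [x]
     term sums to zero. *)
  have -> : \sum_i (x 0 i) ^+ 2 = \sum_i ((i \in B)%:R - b * (i \in B)%:R - b * x 0 i).
    by apply: eq_bigr => i _; rewrite mxE; case: (_ \in _) => /=; ring.
  rewrite !sumrB -!mulr_sumr x0 cardB mulr0 subr0 gerBl.
  by rewrite mulr_ge0 ?ler0n // divr_ge0 ?ler0n.
have xA u : (x *m adj_matrix R G) 0 u = #|[set w in B | G u w]|%:R - b * d%:R.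
  rewrite mxE -sum_indicator -(sum_adj_col R _ G d Gsym Greg u) mulr_sumr -sumrB.
  by apply: eq_bigr => j _; rewrite !mxE Gsym mulrBl.
have := ndl_contraction _ _ _ _ _ _ ndl x0.
move=> /le_trans /(_ (ler_wpM2l (sqr_ge0 lam) x2)) main.
have : \sum_(u in U) (b * d%:R / 2) ^+ 2 <= lam ^+ 2 * #|B|%:R.
  apply: le_trans main; rewrite [leRHS](bigID (mem U)) /=.
  apply: (@le_trans _ _ (\sum_(i in U) (x *m adj_matrix R G) 0 i ^+ 2)); last first.
    by rewrite lerDl sumr_ge0 // => i _; rewrite sqr_ge0.
  apply: ler_sum => u uU; rewrite xA -[leRHS]sqrrN opprB.
  have bd : 0 <= b * d%:R / 2 by rewrite !mulr_ge0 ?ler0n ?invr_ge0 ?ler0n.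
  have := low u uU.
  have -> : d%:R * #|B|%:R / (2 * n%:R) = b * d%:R / 2.
    by rewrite /b; field; rewrite gt_eqF.
  set p := #|_|%:R; move=> pl.
  have bp : b * d%:R / 2 <= b * d%:R - p by lra.
  by rewrite lerXn2r // nnegrE // (le_trans bd).
rewrite sumr_const -[X in X <= _ -> _]mulr_natl => le1.
rewrite -(ler_pM2r BR).
have -> : #|U|%:R * #|B|%:R * d%:R ^+ 2 * #|B|%:R =
   4 * n%:R ^+ 2 * (#|U|%:R * (b * d%:R / 2) ^+ 2).
  by rewrite /b; field; rewrite gt_eqF.
have -> : 4 * lam ^+ 2 * n%:R ^+ 2 * #|B|%:R = 4 * n%:R ^+ 2 * (lam ^+ 2 * #|B|%:R) by ring.
by rewrite ler_wpM2l // mulr_ge0 ?ler0n // sqr_ge0.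
Qed.

End LowDegree.

(** * Counting independent tuples by a potential function *)

Section Count.
Variables (n : nat) (G : rel 'I_n).

(* Entries may repeat when G is irreflexive, so these count maps, not subsets. *)
Definition indep_tuples (B : {set 'I_n}) (t : nat) : {set t.-tuple 'I_n} :=
  [set v : t.-tuple 'I_n | all (mem B) v && pairwise (fun x y => ~~ G x y) v].

Lemma card_indep_tuples0 B : #|indep_tuples B 0| = 1%N.
Proof.
rewrite (_ : indep_tuples B 0 = setT) ?cardsT ?card_tuple //.
by apply/setP => v; rewrite !inE tuple0.
Qed.

(** Classify by the first entry [v]: the remaining entries must avoid its neighbours. *)
Lemma card_indep_tuplesS B t :
  #|indep_tuples B t.+1| = (\sum_(v in B) #|indep_tuples (B :\: [set w | G v w]) t|)%N.
Proof.
pose h (p : 'I_n * t.-tuple 'I_n) : t.+1.-tuple 'I_n := [tuple of p.1 :: p.2].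
pose h' (v : t.+1.-tuple 'I_n) := (thead v, [tuple of behead v]).
have hK : cancel h h'.
  by case=> v w; rewrite /h /h' theadE; congr (_, _); apply: val_inj.
have h'K : cancel h' h by move=> v; rewrite /h /h' [RHS]tuple_eta.
rewrite -sum1_card (reindex h) /=; last by exists h' => ? _.
under [RHS]eq_bigr do rewrite -sum1_card.
rewrite pair_big_dep /=; apply: eq_bigl => -[v w].
rewrite !inE /= -!andbA; congr (_ && _); rewrite !andbA; congr (_ && _).
rewrite andbC -all_predI; apply: eq_all => z /=.
by rewrite !inE andbC.
Qed.

(** [phi] is a potential: one more entry costs a factor [L] in total. Irreflexivity keeps [v] in the
    smaller set, so the induction never meets the empty set. *)
Lemma card_indep_tuples_le (R : realType) (phi : {set 'I_n} -> R) (L : R) :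
  (forall v, ~~ G v v) -> 0 <= L ->
  (forall B, B != set0 -> 1 <= phi B) ->
  (forall B, B != set0 -> \sum_(v in B) phi (B :\: [set w | G v w]) <= L * phi B) ->
  forall t B, B != set0 -> #|indep_tuples B t|%:R <= L ^+ t * phi B.
Proof.
move=> Girr L0 phi1 phiS; elim => [|t IH] B B0.
  by rewrite card_indep_tuples0 expr0 mul1r phi1.
rewrite card_indep_tuplesS natr_sum.
apply: (@le_trans _ _ (\sum_(v in B) L ^+ t * phi (B :\: [set w | G v w]))).
  apply: ler_sum => v vB; apply: IH.
  by apply/set0Pn; exists v; rewrite !inE vB Girr.
by rewrite -mulr_sumr exprSr -mulrA ler_wpM2l ?exprn_ge0 // phiS.
Qed.

End Count.

(** * From few independent tuples to a Ramsey lower bound *)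

(* Union bound over the t-subsets of the m points for a uniformly random map to
   the vertices; as the map need not be injective, m may exceed n. *)
Lemma blowup_not_ramsey n (G : rel 'I_n) s t m :
  simple_graph G -> Ks_free G s -> (0 < t)%N ->
  ('C(m, t) * #|indep_tuples n G setT t| < n ^ t)%N -> ~ ramsey_prop s t m.
Proof.
move=> [Gsym Girr] Gfree t0 small ramsey.
have n0 : (0 < n)%N.
  by move: (leq_ltn_trans (leq0n _) small); rewrite expn_gt0 eqn0Ngt t0 orbF.
pose y0 := Ordinal n0.
pose bad (S : {set 'I_m}) : {set {ffun 'I_m -> 'I_n}} :=
  [set f : {ffun 'I_m -> 'I_n} | [forall x in S, forall y in S, ~~ G (f x) (f y)]].
have card_bad (S : {set 'I_m}) : #|S| = t ->
    (#|bad S| <= #|indep_tuples n G setT t| * n ^ (m - t))%N.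
  move=> cS.
  have szS : size (enum S) == t by rewrite -cardE cS.
  (* A map is recovered from its values on [S] together with the map reset to [y0] on [S]; for a bad
     map the first component is an independent tuple. *)
  pose h (f : {ffun 'I_m -> 'I_n}) :=
    (map_tuple f (Tuple szS), [ffun x => if x \in S then y0 else f x]).
  have h_inj : injective h.
    move=> f g [/eq_in_map fgS /ffunP fgC]; apply/ffunP => x.
    have [xS|xS] := boolP (x \in S); first by apply: fgS; rewrite mem_enum.
    by have := fgC x; rewrite !ffunE (negPf xS).
  pose Z := [set g in pffun_on y0 (mem (~: S)) (mem [set: 'I_n])].
  have cZ : #|Z| = (n ^ (m - t))%N.
    by rewrite cardsE card_pffun_on cardsT card_ord [#|mem _|]cardsCs setCK card_ord cS.
  rewrite -cZ -cardsX -(card_imset _ h_inj); apply/subset_leq_card.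
  apply/subsetP => y /imsetP[f]; rewrite inE => fS ->.
  rewrite !inE /=; apply/andP; split.
    apply/andP; split; first by apply/allP => x _; rewrite /= in_setT.
    rewrite pairwise_map; apply: (@sub_in_pairwise _ (mem S) (fun _ _ => true)).
    - by move=> x z xS zS _; move/forall_inP: fS => /(_ x xS) /forall_inP /(_ z zS).
    - by apply/allP => x; rewrite mem_enum.
    - by elim: (enum S) => //= x l ->; rewrite andbT all_predT.
  apply/pffun_onP; split=> [|_ /imageP[x _ ->]]; last by rewrite inE.
  apply/subsetP => x; rewrite !inE ffunE; apply: contraNN => ->; exact: eqxx.
pose Bad := \bigcup_(S : {set 'I_m} | #|S| == t) bad S.
have : (#|Bad| < #|[set: {ffun 'I_m -> 'I_n}]|)%N.
  apply: (@leq_ltn_trans (\sum_(S : {set 'I_m} | #|S| == t)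
      #|indep_tuples n G setT t| * n ^ (m - t))%N).
    rewrite /Bad; elim/big_rec2: _ => [|S k A /eqP/card_bad Sk Ak]; first by rewrite cards0.
    exact: leq_trans (leq_card_setU _ _) (leq_add Sk Ak).
  rewrite sum_nat_const cardsT card_ffun !card_ord.
  have -> : #|[pred S : {set 'I_m} | #|S| == t]| = 'C(m, t).
    by rewrite -[m in RHS]card_ord -card_draws cardsE.
  have [tm|tm] := leqP t m; last by rewrite bin_small // expn_gt0 n0.
  by rewrite mulnA -[X in (_ < _ ^ X)%N](subnKC tm) expnD ltn_pmul2r ?expn_gt0 ?n0.
(* For a contradiction every map [f] is shown to be bad: the pullback of [G] along [f] has no
   [s]-clique, so the Ramsey property yields an independent [t]-set. *)
rewrite ltnNge => /negP[]; apply/subset_leq_card/subsetP => f _.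
pose G' : rel 'I_m := fun i j => G (f i) (f j).
have G'simple : simple_graph G' by split=> x *; [exact: Gsym | exact: Girr].
case: (ramsey G' G'simple) => [[S [cS Scl]]|[S [cS Sind]]].
  (* [G] has no loops, so adjacent points of the pullback have distinct images and the clique is
     mapped injectively. *)
  case: Gfree; exists (f @: S); split.
    rewrite card_in_imset // => x y xS yS fxy; apply/eqP/negPn/negP => xy.
    by have := Scl x y xS yS xy; rewrite /G' fxy (negPf (Girr _)).
  move=> _ _ /imsetP[x xS ->] /imsetP[y yS ->] fxy; apply: Scl => //.
  by apply: contraNneq fxy => ->.
apply/bigcupP; exists S; first by rewrite cS.
by rewrite inE; apply/forall_inP => x xS; apply/forall_inP => y yS; apply: Sind.
Qed.

(** One term of the exponential series gives [t ^ t <= t! * e ^ t], and ['C(m, t) * t!] is a falling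
    factorial, at most [m ^ t]. *)
Lemma bin_le_exp (R : realType) (m t : nat) : (0 < t)%N ->
  'C(m, t)%:R <= (expR 1 * m%:R / t%:R) ^+ t :> R.
Proof.
move=> t0; have tR : (0 : R) < t%:R by rewrite ltr0n.
have fR : (0 : R) < t`!%:R by rewrite ltr0n fact_gt0.
have ft : t%:R ^+ t <= t`!%:R * expR 1 ^+ t :> R.
  rewrite -expRM_natl mulr1 mulrC -ler_pdivrMr //.
  have := @expR_ge1Dxn R t%:R t.-1 (ltW tR); rewrite prednK // => /(le_trans _); apply.
  by rewrite lerDr ler01.
have ffact : ('C(m, t) * t`! <= m ^ t)%N.
  rewrite bin_ffact; elim: t {t0 tR fR ft} => [|t IH]; first by rewrite ffactn0.
  by rewrite ffactnSr expnSr leq_mul // leq_subr.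
rewrite expr_div_n exprMn ler_pdivlMr ?exprn_gt0 //.
apply: (le_trans (ler_wpM2l (ler0n _ _) ft)).
rewrite mulrA mulrC ler_wpM2l ?exprn_ge0 ?expR_ge0 //.
by rewrite -natrM -natrX ler_nat.
Qed.

(** * Independent tuples in spectrally extremal graphs *)

Section IndependentTuples.
Variables (R : realType) (n : nat) (G : rel 'I_n) (d : nat) (lam C : R).
Hypotheses (ndl : ndl_graph G d lam) (n_gt1 : (1 < n)%N) (d_gt0 : (0 < d)%N).
Hypotheses (C_gt0 : 0 < C) (lam_le : lam <= C * Num.sqrt d%:R).

Lemma ndl_lam_ge0 : 0 <= lam.
Proof. by case: ndl => _ [_ [sp [_ ->]]]; rewrite le_max normr_ge0. Qed.

(** The counted set lies in [B], so its squared size is at most the product bounded by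
    [ndl_low_degree]; a square root gives a bound independent of [B]. *)
Lemma card_low_degree (B : {set 'I_n}) : B != set0 ->
  #|[set v in B | #|[set w in B | G v w]|%:R <= d%:R * #|B|%:R / (2 * n%:R) :> R]|%:R
    <= 2 * C * n%:R / Num.sqrt d%:R :> R.
Proof.
rewrite -card_gt0 => B0; set U := [set v in B | _].
have low : {in U, forall u, #|[set w in B | G u w]|%:R <= d%:R * #|B|%:R / (2 * n%:R) :> R}.
  by move=> u; rewrite inE => /andP[].
have := ndl_low_degree _ _ _ _ _ ndl U B (ltnW n_gt1) B0 low.
have UB : #|U|%:R <= #|B|%:R :> R.
  by rewrite ler_nat subset_leq_card //; apply/subsetP => u; rewrite inE => /andP[].
move: UB; set u : R := #|U|%:R; set b : R := #|B|%:R => ub le1.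
have u0 : 0 <= u by rewrite ler0n.
pose q : R := Num.sqrt d%:R.
have q0 : 0 < q by rewrite sqrtr_gt0 ltr0n.
have qq : q ^+ 2 = d%:R by rewrite sqr_sqrtr ?ler0n.
have n0 : 0 <= n%:R :> R by rewrite ler0n.
have uq : 0 <= u * q by rewrite mulr_ge0 // ltW.
have Cn : 0 <= 2 * C * n%:R by rewrite !mulr_ge0 // ltW.
rewrite ler_pdivlMr // -(@ler_pXn2r _ 2) //.
have q2 : 0 < q ^+ 2 by rewrite exprn_gt0.
rewrite -(ler_pM2r q2).
have lam2 : lam ^+ 2 <= C ^+ 2 * q ^+ 2.
  by rewrite -exprMn lerXn2r // ?nnegrE ?ndl_lam_ge0 // (le_trans ndl_lam_ge0).
have e1 : (u * q) ^+ 2 * q ^+ 2 = u * u * (q ^+ 2) ^+ 2 by ring.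
rewrite -/q e1 qq.
apply: (@le_trans _ _ (u * b * d%:R ^+ 2)).
  by rewrite ler_wpM2r ?sqr_ge0 // ler_wpM2l.
apply: (le_trans le1).
apply: (@le_trans _ _ (4 * (C ^+ 2 * q ^+ 2) * n%:R ^+ 2)).
  by rewrite ler_wpM2r ?sqr_ge0 // ler_wpM2l.
by rewrite le_eqVlt; apply/orP; left; apply/eqP; rewrite -qq; ring.
Qed.

(** Low-degree choices are few and contribute at most [phi B] each; every other choice contributes
    at most [phi B / n], so together at most [phi B]. The full vertex set has potential [e ^ t],
    whence the factor [expR 1]. *)
Lemma ndl_card_indep_tuples t :
  2 * n%:R * ln n%:R ^+ 2 <= t%:R * d%:R :> R ->
  #|indep_tuples n G setT t|%:R <=
    (expR 1 * ((2 * C + 1) * n%:R / Num.sqrt d%:R)) ^+ t :> R.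
Proof.
move=> td.
have [[Gsym Girr] [Greg _]] := ndl.
have nR : (1 : R) < n%:R by rewrite ltr1n.
have n0 : (0 : R) < n%:R by rewrite ltr0n ltnW.
have lnn : 0 < ln (n%:R : R) by rewrite ln_gt0.
have dR : (0 : R) < d%:R by rewrite ltr0n.
have q0 : (0 : R) < Num.sqrt d%:R by rewrite sqrtr_gt0.
pose gam : R := t%:R / ln n%:R.
have gam0 : 0 <= gam by rewrite divr_ge0 ?ler0n ?ltW.
(* phi B = |B|^gam is divided by n whenever B shrinks by the factor 1 - d/(2n). *)
pose phi (B : {set 'I_n}) : R := expR (gam * ln #|B|%:R).
pose L : R := 2 * C * n%:R / Num.sqrt d%:R + 1.
have L0 : 0 <= L by rewrite addr_ge0 // divr_ge0 ?sqrtr_ge0 // !mulr_ge0 // ltW.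
(* Since [ln 0] is [0], the empty set has potential 1 rather than 0, hence the nonemptiness
   condition. *)
have mono (B B' : {set 'I_n}) (y : R) : B' != set0 -> #|B'|%:R <= #|B|%:R * expR (- y) :> R ->
    phi B' <= phi B * expR (- (gam * y)).
  rewrite -card_gt0 -(ltr0n R) => B'0 le.
  have B0 : 0 < #|B|%:R :> R.
    by have := lt_le_trans B'0 le; rewrite pmulr_lgt0 ?expR_gt0.
  rewrite /phi -expRD ler_expR -mulrN -mulrDr ler_wpM2l //.
  rewrite -[X in _ + X]expRK -lnM ?posrE ?expR_gt0 //.
  by rewrite ler_ln ?posrE // mulr_gt0 ?expR_gt0.
have phi1 B : B != set0 -> 1 <= phi B.
  by rewrite -card_gt0 => B0; rewrite /phi -[leLHS]expR0 ler_expR mulr_ge0 // ln_ge0 // ler1n.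
have phiS B : B != set0 -> \sum_(v in B) phi (B :\: [set w | G v w]) <= L * phi B.
  move=> B0; have phiB : 0 <= phi B by rewrite expR_ge0.
  have ne v : v \in B -> B :\: [set w | G v w] != set0.
    by move=> vB; apply/set0Pn; exists v; rewrite !inE vB Girr.
  pose low v := #|[set w in B | G v w]|%:R <= d%:R * #|B|%:R / (2 * n%:R) :> R.
  rewrite (bigID low) /= mulrDl mul1r; apply: lerD.
    apply: (@le_trans _ _ (\sum_(v in B | low v) phi B)).
      apply: ler_sum => v /andP[vB _].
      have := mono B _ 0 (ne v vB).
      rewrite mulr0 oppr0 expR0 !mulr1; apply.
      by rewrite ler_nat subset_leq_card // subsetDl.
    rewrite sumr_const -[leLHS]mulr_natl ler_wpM2r //.
    by apply: le_trans (card_low_degree _ B0); rewrite cardsE.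
  apply: (@le_trans _ _ (\sum_(v : 'I_n) phi B / n%:R)); last first.
    by rewrite sumr_const card_ord -[leLHS]mulr_natr divfK // gt_eqF.
  rewrite [leRHS](bigID (fun v => (v \in B) && ~~ low v)) /=.
  apply: ler_wpDr; first by apply: sumr_ge0 => v _; rewrite divr_ge0 // ltW.
  apply: ler_sum => v /andP[vB]; rewrite -ltNge => high.
  pose y : R := d%:R / (2 * n%:R).
  apply: (@le_trans _ _ (phi B * expR (- (gam * y)))).
    apply: mono (ne v vB) _.
    have -> : #|B :\: [set w | G v w]|%:R = #|B|%:R - #|[set w in B | G v w]|%:R :> R.
      have BN : B :&: [set w | G v w] = [set w in B | G v w].
        by apply/setP => w; rewrite !inE.
      by apply/eqP; rewrite eq_sym subr_eq -natrD addnC -BN cardsID.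
    apply: (@le_trans _ _ (#|B|%:R * (1 - y))).
      by rewrite mulrBr mulr1 lerD2l lerN2 ltW // (le_lt_trans _ high) // /y mulrCA mulrA.
    by rewrite ler_wpM2l ?ler0n // expR_ge1Dx.
  (* The factor is at most [1 / n] exactly when [gam * y >= ln n], which is the hypothesis [td]. *)
  rewrite ler_wpM2l // -[X in _ <= X^-1](lnK (x := n%:R)) ?posrE // -expRN ler_expR lerN2.
  rewrite /gam /y mulrACA -invfM ler_pdivlMr ?mulr_gt0 //.
  apply: le_trans td; rewrite le_eqVlt; apply/orP; left; apply/eqP; ring.
have T0 : [set: 'I_n] != set0 by rewrite -card_gt0 cardsT card_ord ltnW.
apply: (le_trans (card_indep_tuples_le _ _ _ phi L Girr L0 phi1 phiS t _ T0)).
have -> : phi setT = expR 1 ^+ t.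
  by rewrite /phi cardsT card_ord divfK ?gt_eqF // -expRM_natl mulr1.
rewrite -exprMn lerXn2r ?nnegrE ?mulr_ge0 ?expR_ge0 //.
  by rewrite addr_ge0 // mulr_ge0 // ltW.
  by rewrite ltW // invr_gt0.
rewrite mulrC ler_wpM2l ?expR_ge0 // /L.
have -> : (2 * C + 1) * n%:R / Num.sqrt d%:R =
    2 * C * n%:R / Num.sqrt d%:R + n%:R / Num.sqrt d%:R :> R by ring.
rewrite lerD2l ler_pdivlMr // mul1r.
(* From [d <= n <= n ^ 2] the ratio [n / sqrt d] is at least 1 and absorbs the summand 1 of [L]. *)
have dn : (d <= n)%N.
  have v := Ordinal (ltnW n_gt1).
  by rewrite -(Greg v) -[leqRHS]card_ord max_card.
rewrite -[leRHS]ger0_norm ?ler0n // -sqrtr_sqr ler_sqrt ?sqr_ge0 // -natrX ler_nat.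
by rewrite (leq_trans dn) // -mulnn leq_pmulr // ltnW.
Qed.

(** For [m] below the bound, the product in [blowup_not_ramsey] drops below [n ^ t]. The binomial
    and the tuple count each contribute one factor [e] per entry, hence [expR 1 ^+ 2]. *)
Lemma ndl_ramsey_ge s t : Ks_free G s -> (0 < t)%N ->
  2 * n%:R * ln n%:R ^+ 2 <= t%:R * d%:R :> R ->
  ramsey_ge s t (t%:R * Num.sqrt d%:R / (expR 1 ^+ 2 * (2 * C + 1))).
Proof.
move=> Gfree t0 td m ram; rewrite leNgt; apply/negP => mlt.
have [Gsimple _] := ndl.
apply: (blowup_not_ramsey _ _ _ _ _ Gsimple Gfree t0 _ ram).
rewrite -(ltr_nat R) natrM natrX.
have n0 : (0 : R) < n%:R by rewrite ltr0n ltnW.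
have tR : (0 : R) < t%:R by rewrite ltr0n.
have q0 : (0 : R) < Num.sqrt d%:R by rewrite sqrtr_gt0 ltr0n.
have C1 : 0 < 2 * C + 1 by rewrite addr_gt0 // mulr_gt0.
have e0 := expR_gt0 (1 : R).
apply: (le_lt_trans (ler_pM (ler0n _ _) (ler0n _ _) (bin_le_exp R m t t0)
   (ndl_card_indep_tuples t td))).
rewrite -exprMn ltr_pXn2r ?nnegrE ?ler0n ?mulr_ge0 ?invr_ge0 ?sqrtr_ge0 ?ler0n
  ?expR_ge0 //; last exact: ltW.
rewrite ltr_pdivlMr ?mulr_gt0 ?exprn_gt0 // in mlt.
have -> : expR 1 * m%:R / t%:R * (expR 1 * ((2 * C + 1) * n%:R / Num.sqrt d%:R))
  = (m%:R * (expR 1 ^+ 2 * (2 * C + 1))) * n%:R / (t%:R * Num.sqrt d%:R) :> R.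
  by field; rewrite !gt_eqF.
by rewrite ltr_pdivrMr ?mulr_gt0 // mulrC ltr_pM2l.
Qed.

End IndependentTuples.

(** * Choice of parameters and conclusion *)

(** The cubic term of the exponential series at [ln t], with 6 = 3!. It makes [t / ln t ^+ 2] exceed
    any constant for large [t]. *)
Lemma ln_le_ratio_ln_sqr (R : realType) (t : R) : 1 < t -> ln t / 6 <= t / ln t ^+ 2.
Proof.
move=> t1; have l0 := ln_gt0 t1.
rewrite ler_pdivlMr ?exprn_gt0 // mulrAC -exprS.
have := @expR_ge1Dxn R (ln t) 2 (ltW l0).
rewrite lnK ?posrE ?(lt_trans ltr01) // => /(le_trans _); apply.
by rewrite lerDr ler01.
Qed.

(** For [n = k ^ (2 * s - 3)] it turns the real power in the degree hypothesis into a natural power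
    of [k]. *)
Lemma powR_exp_root (R : realType) (k p : nat) :
  powR ((k ^ p.+1)%:R : R) (1 - p.+1%:R^-1) = k%:R ^+ p.
Proof.
rewrite natrX -powR_mulrn ?ler0n // -powRrM.
have -> : p.+1%:R * (1 - p.+1%:R^-1) = p%:R :> R.
  by rewrite mulrBr mulr1 divff ?pnatr_eq0 // -natr1 addrK.
by rewrite powR_mulrn ?ler0n.
Qed.

Theorem theorem4 (R : realType) (s : nat) (hs : (3 <= s)%N) (C c : R)
  (hC : 0 < C) (hc : 0 < c)
  (hyp : exists N : nat, forall n : nat, (N <= n)%N ->
     exists (G : rel 'I_n) (d : nat) (lam : R),
       ndl_graph G d lam /\ Ks_free G s /\
       lam <= C * Num.sqrt (d%:R) /\
       c * powR (n%:R) (1 - (2 * s - 3)%:R^-1) <= d%:R) :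
  exists c' : R, 0 < c' /\
    exists T : nat, forall t : nat, (T <= t)%N ->
      ramsey_ge s t (c' * (t%:R) ^+ (s - 1) / (ln (t%:R)) ^+ (2 * s - 4)).
Proof.
have [N HN] := hyp.
case: s hs HN {hyp} => [|[|p]] // p1 HN.
have e3 : (2 * p.+2 - 3 = (2 * p).+1)%N by rewrite mulnS; lia.
have e4 : (2 * p.+2 - 4 = 2 * p)%N by lia.
have e1 : (p.+2 - 1 = p.+1)%N by lia.
rewrite e4 e1; rewrite e3 in HN.
pose r : R := (2 * p).+1%:R.
have r0 : 0 < r by rewrite ltr0n.
(* The bound 1 yields [k <= t], hence [ln k <= ln t]; the other bound yields the size condition
   [cond]. *)
pose kappa : R := Num.min 1 (c / (2 * r ^+ 2)).
have kappa0 : 0 < kappa by rewrite lt_min ltr01 divr_gt0 // mulr_gt0 // exprn_gt0.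
have kappa1 : kappa <= 1 by rewrite ge_min lexx.
have kappac : 2 * r ^+ 2 * kappa <= c.
  by rewrite mulrC -ler_pdivlMr ?mulr_gt0 ?exprn_gt0 // ge_min lexx orbT.
pose K : R := expR 1 ^+ 2 * (2 * C + 1).
have K0 : 0 < K by rewrite mulr_gt0 ?exprn_gt0 ?expR_gt0 // addr_gt0 // mulr_gt0.
(* [sqrt c] comes from the lower bound on [d], the 2 from rounding [Y] down to [k], and [K] from
   [ndl_ramsey_ge]. *)
exists (Num.sqrt c * (kappa / 2) ^+ p / K); split.
  by rewrite divr_gt0 // mulr_gt0 ?sqrtr_gt0 // exprn_gt0 // divr_gt0.
(* Chosen so that [ln t >= M] forces [kappa * (ln t / 6) >= N + 2]. *)
pose M : R := 6 * (N + 2)%:R / kappa.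
have M12 : 1 <= M.
  rewrite ler_pdivlMr // mul1r (le_trans kappa1) //.
  have : (2 : R) <= (N + 2)%:R by rewrite ler_nat leq_addl.
  lra.
exists (Num.truncn (expR M)).+1 => t tT.
pose l : R := ln t%:R.
have tM : expR M < t%:R.
  have /andP[_ lt1] := truncn_itv (expR_ge0 M).
  by rewrite (lt_le_trans lt1) // ler_nat.
have t1 : 1 < t%:R :> R by rewrite (le_lt_trans _ tM) // -expR0 ler_expR (le_trans ler01).
have t0 : 0 < t%:R :> R by rewrite (lt_trans ltr01).
have lM : M <= l by rewrite -ler_expR lnK ?posrE // ltW.
have l1 : 1 <= l := le_trans M12 lM.
have l0 : 0 < l := lt_le_trans ltr01 l1.
pose Y : R := kappa * (t%:R / l ^+ 2).
have Y0 : 0 <= Y by rewrite mulr_ge0 ?divr_ge0 ?exprn_ge0 // ltW.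
have YN : (N + 2)%:R <= Y.
  apply: (@le_trans _ _ (kappa * (l / 6))); last first.
    by rewrite ler_pM2l // ln_le_ratio_ln_sqr.
  move: lM; rewrite /M ler_pdivrMr // => lM; lra.
pose k := Num.truncn Y.
have /andP[kY Yk] := truncn_itv Y0.
rewrite -/k in kY Yk.
(* [N] makes the hypothesis applicable to [n = k ^ (2 * p).+1]; the extra 2 ensures [1 < n]. *)
have kN : (N + 2 <= k)%N by rewrite -ltnS -(ltr_nat R) (le_lt_trans YN).
have k_gt1 : (1 < k)%N by apply: leq_trans kN; rewrite addn2.
have k_gt0 : (0 < k)%N := ltnW k_gt1.
have k_le_exp : (k <= k ^ (2 * p).+1)%N.
  by rewrite -[X in (X <= _)%N]expn1 leq_pexp2l.
have k0 : 0 < k%:R :> R by rewrite ltr0n.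
(* As [k >= 1], [Y < k + 1 <= 2 * k]. *)
have Y2k : Y / 2 <= k%:R.
  have : 1 <= k%:R :> R by rewrite ler1n.
  move: Yk; rewrite -natr1; lra.
have Yt : Y <= t%:R.
  apply: (@le_trans _ _ (1 * (t%:R / 1))); last by rewrite mul1r divr1.
  rewrite ler_pM ?divr_ge0 ?exprn_ge0 // ?(ltW kappa0) ?(ltW t0) ?(ltW l0) //.
  by rewrite ler_pM2l // lef_pV2 ?posrE ?exprn_gt0 // exprn_ege1.
have [G [d [lam [ndl [Gfree [lamle dge]]]]]] :
    exists (G : rel 'I_(k ^ (2 * p).+1)) (d : nat) (lam : R),
    ndl_graph G d lam /\ Ks_free G p.+2 /\ lam <= C * Num.sqrt (d%:R) /\
    c * k%:R ^+ (2 * p) <= d%:R.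
  rewrite -powR_exp_root; apply: HN.
  by apply: leq_trans k_le_exp; apply: leq_trans kN; rewrite leq_addr.
have n1 : (1 < k ^ (2 * p).+1)%N := leq_trans k_gt1 k_le_exp.
have d0 : (0 < d)%N.
  by rewrite -(ltr0n R) (lt_le_trans _ dge) // mulr_gt0 // exprn_gt0.
have tn0 : (0 < t)%N by rewrite -(ltr0n R).
(* With [k <= Y] and [ln n = r * ln k <= r * l], the factor [l ^+ 2] cancels the denominator of [Y],
   leaving [2 * r ^+ 2 * kappa <= c]. *)
have cond : 2 * (k ^ (2 * p).+1)%:R * ln (k ^ (2 * p).+1)%:R ^+ 2 <= t%:R * d%:R :> R.
  have lnk : 0 <= ln (k%:R : R) <= l.
    by rewrite ln_ge0 ?ler1n //= ler_ln ?posrE // (le_trans kY).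
  apply: (@le_trans _ _ (t%:R * (c * k%:R ^+ (2 * p)))); last by rewrite ler_pM2l.
  rewrite natrX lnXn // -[ln _ *+ _]mulr_natl -/r exprS.
  have kp : 0 < k%:R ^+ (2 * p) :> R by rewrite exprn_gt0.
  apply: (@le_trans _ _ (2 * (Y * k%:R ^+ (2 * p)) * (r * l) ^+ 2)).
    apply: ler_pM.
    - by rewrite !mulr_ge0 // ltW.
    - by rewrite sqr_ge0.
    - by rewrite ler_pM2l // ler_pM2r.
    - case/andP: lnk => lnk0 lnkl.
      by rewrite lerXn2r ?nnegrE ?mulr_ge0 ?(ltW r0) ?(ltW l0) // ler_pM2l.
  have -> : 2 * (Y * k%:R ^+ (2 * p)) * (r * l) ^+ 2 =
      t%:R * (2 * r ^+ 2 * kappa * k%:R ^+ (2 * p)).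
    by rewrite /Y; field; rewrite gt_eqF.
  by rewrite ler_pM2l // ler_pM2r.
move=> m /(ndl_ramsey_ge R _ _ _ _ _ ndl n1 d0 hC lamle _ _ Gfree tn0 cond).
apply: le_trans.
have sqd : Num.sqrt c * k%:R ^+ p <= Num.sqrt d%:R.
  have -> : Num.sqrt c * k%:R ^+ p = Num.sqrt (c * k%:R ^+ (2 * p)).
    by rewrite sqrtrM ?ltW // mulnC exprM sqrtr_sqr ger0_norm // exprn_ge0 // ltW.
  by rewrite ler_sqrt ?ler0n // ltW.
have -> : Num.sqrt c * (kappa / 2) ^+ p / K * t%:R ^+ p.+1 / l ^+ (2 * p) =
    t%:R * (Num.sqrt c * (Y / 2) ^+ p) / K.
  rewrite /Y !exprMn !exprVn -exprM exprS; field.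
  by rewrite !expf_neq0 ?gt_eqF.
rewrite -/K ler_pM2r ?invr_gt0 // ler_pM2l // (le_trans _ sqd) //.
rewrite ler_wpM2l ?sqrtr_ge0 // lerXn2r ?nnegrE ?(ltW k0) //.
by rewrite divr_ge0.
Qed.
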